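(* Let $f\in\mathcal M(\mathbf R)$, and suppose that $d_j=u_j-\mathbf E_{j-1}u_j$, $j=1,2,\ldots$, for some integrable real random variables $u_j$, and that $\lambda>0$ is such that $\mathbf E e^{\lambda u_j}<\infty$ for $j=1,2,\ldots$. Put $e_j=\mathbf E_{j-1}\left(e^{\lambda u_j}-1-\lambda u_j\right)$. Then for all $r\ge0$, $$\mathbf{Pr}(f^*_+\ge r)\le\exp\left\{-\lambda r+\left\|\sum_{j=1}^\infty e_j\right\|_\infty\right\}.$$ If, besides, $\mathbf E_{j-1}u_j\ge0$ for all $j=1,2,\ldots$, then, moreover, for all $r\ge 0$, $$\mathbf{Pr}(f^*_+\ge r)\le e^{-\lambda r}\left\|\prod_{j=1}^\infty(1+e_j)\right\|_\infty.$$
   Context: $\mathcal M(\mathbf R)$ is the class of all real-valued martingales $f=(f_0,f_1,\ldots)$ with $f_0\equiv0$ on some probability space with respect to some filtration $(F_0,F_1,\ldots)$ (both may depend on $f$). Put $d_j=f_j-f_{j-1}$ for $j\ge1$ and $f^*_+=\sup_{j\ge0}f_j$; $\mathbf E_{j-1}$ is the conditional expectation given $F_{j-1}$; $\|\cdot\|_\infty$ of a random variable is its essential supremum norm (possibly $+\infty$). *)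

(* Defs.v *)
From HB Require Import structures.
From mathcomp Require Import all_boot all_order all_algebra.
From mathcomp Require Import all_classical all_reals all_analysis.
Set Implicit Arguments.
Unset Strict Implicit.
Unset Printing Implicit Defensive.
Import Order.TTheory GRing.Theory Num.Theory.
Import numFieldNormedType.Exports.
Local Open Scope classical_set_scope.
Local Open Scope ring_scope.

Section martingales.
Context {d : measure_display} {T : measurableType d} {R : realType}.

Definition is_filtration (F : nat -> set_system T) : Prop :=
  [/\ forall n, sigma_algebra [set: T] (F n),
      forall n, F n `<=` measurable &
      forall m n, (m <= n)%N -> F m `<=` F n].

(* For a sigma-algebra [G], [measurable] on [g_sigma_algebraType G] is [G]. *)
Definition measurable_wrt (G : set_system T) (X : T -> R) : Prop :=
  measurable_fun [set: g_sigma_algebraType G] (X : g_sigma_algebraType G -> R).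

(* [Y] is a version of the conditional expectation of the integrable random
   variable [X] given the sub-sigma-algebra [G]; versions are unique only up to
   a [P]-null set. *)
Definition is_cond_expectation (P : probability T R) (G : set_system T)
    (X Y : T -> R) : Prop :=
  [/\ measurable_wrt G Y,
      P.-integrable [set: T] (EFin \o Y) &
      forall A, G A ->
        (\int[P]_(w in A) (Y w)%:E = \int[P]_(w in A) (X w)%:E)%E].

Definition is_martingale (P : probability T R) (F : nat -> set_system T)
    (f : nat -> T -> R) : Prop :=
  [/\ is_filtration F,
      forall n, measurable_wrt (F n) (f n),
      forall n, P.-integrable [set: T] (EFin \o f n) &
      forall n, is_cond_expectation P (F n) (f n.+1) (f n)].

Definition is_martingale_from0 (P : probability T R) (F : nat -> set_system T)
    (f : nat -> T -> R) : Prop :=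
  is_martingale P F f /\ (forall w, f 0%N w = 0).

(* Meant for [1 <= j]. *)
Definition mdiff (f : nat -> T -> R) (j : nat) (w : T) : R :=
  f j w - f j.-1 w.

Definition maxfun (f : nat -> T -> R) (w : T) : \bar R :=
  ereal_sup (range (fun j => (f j w)%:E)).

(* When all [e j w] with [1 <= j] are nonnegative (almost surely the case for
   the [e] of the theorem) both limits below exist in [0, +oo]. *)
Definition sum_from1 (e : nat -> T -> R) (w : T) : \bar R :=
  (\sum_(1 <= j <oo) (e j w)%:E)%E.

Definition prod1D_from1 (e : nat -> T -> R) (w : T) : \bar R :=
  limn (fun n => (\prod_(1 <= j < n) (1 + e j w))%:E).

End martingales.

(* Main.v *)
Require Import Defs.
From HB Require Import structures.
From mathcomp Require Import all_boot all_order all_algebra.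
From mathcomp Require Import all_classical all_reals all_analysis.
From mathcomp Require Import measurable_realfun ess_sup_inf.
From mathcomp Require Import ring lra.
Set Implicit Arguments.
Unset Strict Implicit.
Unset Printing Implicit Defensive.
Import Order.TTheory GRing.Theory Num.Theory.
Import numFieldNormedType.Exports.
Local Open Scope classical_set_scope.
Local Open Scope ring_scope.

(** Write [E_(j-1)] for conditional expectation given [F (j-1)].  Let
    [a_j > 0] be [F (j-1)]-measurable with [E_(j-1) exp (lambda * d_j) <= a_j].
    Then [Z_n = exp (lambda * f_n) / (a_1 * ... * a_n)] is a nonnegative
    supermartingale starting at [1], so by Ville's maximal inequality
    ([ville_inequality]) [Z] ever reaches the level [c] with probability at
    most [1 / c].  If all products [a_1 * ... * a_n] are almost surely at most
    [M], then wherever the supremum of [f] is at least [r], every level below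
    [exp (lambda * r) / M] is reached by some [Z_n].  Hence that event has
    probability at most [M * exp (- lambda * r)]
    ([exponential_maximal_inequality]).

    It remains to choose the [a_j].  Put [m = lambda * E_(j-1) u_j].  Since
    [E_(j-1) exp (lambda * u_j) = 1 + e_j + m],
    [[
      E_(j-1) exp (lambda * d_j) = (1 + e_j + m) * exp (- m).
    ]]
    The inequality [1 + x <= exp x] bounds this by [exp e_j], whose partial
    products are at most the exponential of the norm of the sum.  When
    [m >= 0], the inequalities [e_j >= 0] and [exp m >= 1 + m] bound it by
    [1 + e_j], whose partial products increase to the infinite product.

    Conditional expectations enter only through the integrals that define them.
    Multiplying by an unbounded nonnegative [F (j-1)]-measurable factor, such
    as [Z_(j-1)], is justified by monotone convergence
    ([eq_ge0_integral_mul]); all integrands are nonnegative, so it does not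
    matter whether [exp (lambda * f_n)] is integrable. *)

(** * Integration against functions measurable for a sub-sigma-algebra *)

Section sub_sigma_algebra.
Context {d : measure_display} {T : measurableType d} {R : realType}.
Variables (P : probability T R) (G : set_system T).
Hypotheses (sG : sigma_algebra [set: T] G) (GT : G `<=` measurable).

Lemma measurable_wrt_preimage (X : T -> R) (B : set R) :
  measurable_wrt G X -> measurable B -> G (X @^-1` B).
Proof.
move=> mX mB; have := mX measurableT B mB.
by rewrite setTI /measurable /= (sigma_algebra_id sG).
Qed.

Lemma measurable_wrt_measurable (X : T -> R) :
  measurable_wrt G X -> measurable_fun [set: T] X.
Proof.
move=> mX _ B mB; rewrite setTI.
exact/GT/measurable_wrt_preimage.
Qed.

Import HBNNSimple.
Local Open Scope ereal_scope.

(** Expanding the simple function [g] over its level sets, which belong to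
    [G], reduces the integral to integrals of [X] over members of [G]. *)
Let integral_nnsfun_mul (g : {nnsfun (g_sigma_algebraType G) >-> R})
    (X : T -> \bar R) :
  measurable_fun [set: T] X -> (forall w, 0 <= X w) ->
  \int[P]_w ((g w)%:E * X w) =
  \sum_(y \in range g) y%:E * \int[P]_(w in g @^-1` [set y]) X w.
Proof.
move=> mX X0.
have mg y : measurable (g @^-1` [set y] : set T).
  by apply/GT/measurable_wrt_preimage => //; exact: measurable_funP.
have mi y : measurable_fun [set: T] (fun w : T => (y * \1_(g @^-1` [set y]) w)%:E).
  by apply/measurable_EFinP/measurable_funM => //; exact: measurable_indic.
transitivity (\int[P]_w (\sum_(y \in range g)
    (y * \1_(g @^-1` [set y]) w)%:E * X w)).
  apply: eq_integral => w _.
  rewrite -ge0_mule_fsuml => [|y]; last exact: nnfun_muleindic_ge0.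
  by rewrite fsumEFin//; congr (_%:E * _); exact: (fimfunE g w).
rewrite ge0_integral_fsum//; last 2 first.
  by move=> y; apply: emeasurable_funM.
  by move=> y w _; rewrite mule_ge0// nnfun_muleindic_ge0.
apply: eq_fsbigr => y /set_mem[w _ gwy].
under eq_integral do rewrite EFinM -muleA.
rewrite ge0_integralZl//.
- congr (_ * _); rewrite [RHS]integral_mkcond; apply: eq_integral => v _.
  by rewrite epatch_indic muleC.
- apply: emeasurable_funM => //.
  by apply/measurable_EFinP; exact: measurable_indic.
- by move=> v _; rewrite mule_ge0// lee_fin.
- by rewrite lee_fin -gwy.
Qed.

(** This is the rule for taking a known factor out of a conditional
    expectation.  In applications [W * X] need not be integrable, so everything
    is kept nonnegative; [W] is an increasing limit of [G]-measurable simple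
    functions and monotone convergence applies on both sides. *)
Lemma eq_ge0_integral_mul (X Y W : T -> R) :
  measurable_fun [set: T] X -> measurable_fun [set: T] Y ->
  (forall w, 0 <= X w)%R -> (forall w, 0 <= Y w)%R ->
  (forall A, G A -> \int[P]_(w in A) (X w)%:E = \int[P]_(w in A) (Y w)%:E) ->
  measurable_wrt G W -> (forall w, 0 <= W w)%R ->
  \int[P]_w (W w * X w)%:E = \int[P]_w (W w * Y w)%:E.
Proof.
move=> mX mY X0 Y0 XY mW W0.
have mW' : measurable_fun [set: g_sigma_algebraType G] (EFin \o W).
  exact/measurable_EFinP.
pose g := nnsfun_approx measurableT mW'.
have gW w : (g n w)%:E @[n --> \oo] --> (W w)%:E.
  by apply: (cvg_nnsfun_approx measurableT mW') => // v _; rewrite lee_fin.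
have lim (Z : T -> R) : measurable_fun [set: T] Z -> (forall w, 0 <= Z w)%R ->
    \int[P]_w (W w * Z w)%:E = limn (fun n => \int[P]_w ((g n w)%:E * (Z w)%:E)).
  move=> mZ Z0; rewrite -monotone_convergence//=.
  - apply: eq_integral => w _; apply/esym/cvg_lim => //.
    by rewrite EFinM; apply: cvgeZr.
  - move=> n; apply: emeasurable_funM; apply/measurable_EFinP => //.
    by apply: measurable_wrt_measurable; exact: measurable_funP.
  - by move=> n w _; rewrite mule_ge0// lee_fin.
  - move=> w _ m n mn; rewrite lee_wpmul2r// lee_fin//.
    by have /lefP := nd_nnsfun_approx measurableT mW' mn; exact.
rewrite !lim//; congr (limn _); apply/funext => n.
rewrite !integral_nnsfun_mul//; try by
  [move=> w; rewrite lee_fin | exact/measurable_EFinP].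
apply: eq_fsbigr => y _; congr (_ * _).
by apply: XY; apply: measurable_wrt_preimage => //; exact: measurable_funP.
Qed.

End sub_sigma_algebra.

(** * Ville's maximal inequality *)

Section ville.
Context {d : measure_display} {T : measurableType d} {R : realType}.
Variables (P : probability T R) (F : nat -> set_system T).
Hypothesis filF : is_filtration F.
Local Open Scope ereal_scope.

(** Stopping [Z] when it first reaches [c] preserves the supermartingale
    property.  Discarding the part that has not yet stopped and bounding the
    stopped part below by [c] gives the inequality up to any finite time;
    continuity of [P] along increasing events does the rest. *)
Lemma ville_inequality (Z : nat -> T -> R) (c : R) :
  (forall n w, 0 <= Z n w)%R ->
  (forall n, measurable_wrt (F n) (Z n)) ->
  (forall n A, F n A ->
    \int[P]_(w in A) (Z n.+1 w)%:E <= \int[P]_(w in A) (Z n w)%:E) ->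
  (0 <= c)%R ->
  c%:E * P (\bigcup_n [set w | (c <= Z n w)%R]) <= \int[P]_w (Z 0%N w)%:E.
Proof.
case: filF => sF Fm ndF Z0 mZ superZ c0.
pose D n := [set w | (c <= Z n w)%R].
(* [U n] is the event that the level [c] is reached strictly before time [n];
   it is known at time [n.-1], so that its complement may be used as a
   conditioning event when passing from [n.-1] to [n]. *)
pose U n := \big[setU/set0]_(k < n) D k.
have FE n : (measurable : set_system (g_sigma_algebraType (F n))) = F n.
  exact: sigma_algebra_id.
have FD n : F n (D n).
  rewrite (_ : D n = Z n @^-1` `[c, +oo[%classic); last first.
    by apply/seteqP; split=> w; rewrite /= in_itv/= andbT.
  by apply: measurable_wrt_preimage.
have FU m n : (n <= m.+1)%N -> F m (U n).
  move=> nm; rewrite -FE; apply: bigsetU_measurable => k _; rewrite FE.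
  by apply: ndF (FD k); rewrite -ltnS (leq_trans _ nm).
have mU n : measurable (U n) by apply: (Fm n); exact: FU.
have mT n : measurable_fun [set: T] (EFin \o Z n).
  by apply/measurable_EFinP/(measurable_wrt_measurable (sF n)).
(* The left-hand side is a lower bound for the mean of the stopped process. *)
have stopped n : c%:E * P (U n) + \int[P]_(w in ~` U n) (Z n w)%:E
    <= \int[P]_w (Z 0%N w)%:E.
  elim: n => [|n IH]; first by rewrite /U big_ord0 measure0 mule0 add0e setC0.
  have mDU : measurable (D n `\` U n) by apply: measurableD => //; exact: Fm.
  have US : U n.+1 = U n `|` (D n `\` U n).
    by rewrite /U big_ord_recr/= setUDr setDv setUC setD0 setUC.
  have CU : ~` U n = (D n `\` U n) `|` ~` U n.+1.
    rewrite /U big_ord_recr /= setCU -/(U n) setDE (setIC _ (~` U n)) -setIUr.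
    by rewrite setUv setIT.
  have disj1 : [disjoint U n & D n `\` U n].
    by rewrite disj_set2E setDE setICA setICr setI0.
  have disj2 : [disjoint D n `\` U n & ~` U n.+1].
    by rewrite disj_set2E US setCU setICA setICr setI0.
  apply: le_trans IH; rewrite {1}US measureU//; last exact/disj_set2P.
  rewrite [in leRHS]CU ge0_integral_setU//; last 3 first.
  - exact: measurableC.
  - exact: (measurable_funTS (mT n)).
  - by move=> w _; rewrite lee_fin.
  rewrite muleDr//; last by rewrite ge0_adde_def// inE.
  rewrite -addeA leeD2l// leeD//; last first.
    by apply: superZ; rewrite -FE; apply: measurableC; rewrite FE; exact: FU.
  rewrite -integral_cst//; apply: ge0_le_integral => //.
  - exact: (measurable_funTS (mT n)).
  - by move=> w [Dw _]; rewrite lee_fin.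
have PU n : c%:E * P (U n) <= \int[P]_w (Z 0%N w)%:E.
  apply: le_trans (stopped n); rewrite leeDl// integral_ge0// => w _.
  by rewrite lee_fin.
have : c%:E * P (U n) @[n --> \oo] --> c%:E * P (\bigcup_n U n).
  apply: cvgeZl => //; apply: nondecreasing_cvg_mu => //.
    exact: bigcup_measurable.
  by move=> m n mn; apply/subsetPset; exact: subset_bigsetU.
have -> : \bigcup_n U n = \bigcup_n D n.
  rewrite -(bigcup_bigsetU_bigcup D); apply/seteqP; split=> w [n _ Uw].
    by exists n => //; rewrite /U big_ord_recr/=; left.
  by exists n.+1.
move=> cvU; rewrite -(cvg_lim _ cvU)//.
by apply: lime_le; [apply/cvg_ex; eexists; exact: cvU|exact: nearW].
Qed.
End ville.

(** * The maximal inequality for exponential supermartingales *)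

Lemma measurable_fun_inv_gt0 {d : measure_display} {T : measurableType d}
    {R : realType} (g : T -> R) : (forall w, 0 < g w) ->
  measurable_fun [set: T] g -> measurable_fun [set: T] (fun w => (g w)^-1).
Proof.
move=> g0 mg; under eq_fun do rewrite -powR_inv1 ?ltW//.
by apply: (measurableT_comp (measurable_powR (-1))).
Qed.

Section exponential_supermartingale.
Context {d : measure_display} {T : measurableType d} {R : realType}.
Variables (P : probability T R) (F : nat -> set_system T).
Hypothesis filF : is_filtration F.

Lemma measurable_maxfun (f : nat -> T -> R) :
  (forall n, measurable_fun [set: T] (f n)) -> measurable_fun [set: T] (maxfun f).
Proof.
move=> mf.
rewrite (_ : maxfun f = fun w => esups (fun n => (f n w)%:E) 0%N).
  by apply: measurable_fun_esups => n; exact/measurable_EFinP.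
apply/funext => w; congr ereal_sup; apply/seteqP.
by split=> [x [n _ <-]|x [n _ <-]]; exists n.
Qed.

(** The hypothesis on the integrals of [W * expR _] says that [a n.+1]
    dominates the conditional expectation of [expR (lambda * d_(n+1))], tested
    against all nonnegative [F n]-measurable weights; this makes sense without
    any integrability of the weights. *)
Lemma exponential_maximal_inequality (f a : nat -> T -> R) (lambda M r : R) :
  (forall n, measurable_wrt (F n) (f n)) -> (forall w, f 0%N w = 0) ->
  (forall n, measurable_wrt (F n) (a n.+1)) -> (forall n w, 0 < a n w) ->
  (forall n (W : T -> R), measurable_wrt (F n) W -> (forall w, 0 <= W w) ->
    (\int[P]_w (W w * expR (lambda * mdiff f n.+1 w))%:E
     <= \int[P]_w (W w * a n.+1 w)%:E)%E) ->
  0 < lambda -> 0 < M ->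
  (forall n, \forall w \ae P, \prod_(1 <= j < n.+1) a j w <= M) ->
  (P [set w | r%:E <= maxfun f w] <= (expR (- (lambda * r)) * M)%:E)%E.
Proof.
move=> mf f0 ma a0 step l0 M0 leM.
case: (filF) => sF Fm ndF.
pose A n w := \prod_(1 <= j < n.+1) a j w.
have A0 n w : 0 < A n w by apply: prodr_gt0.
have mA n : measurable_wrt (F n) (A n).
  rewrite /A /measurable_wrt; apply: measurable_prod => -[|j].
    by rewrite mem_index_iota.
  rewrite mem_index_iota ltnS /= => jn _ B mB.
  have := ma j measurableT B mB.
  by rewrite /measurable/= !(sigma_algebra_id (sF _)); apply: ndF; exact: ltnW.
have AS n w : A n.+1 w = A n w * a n.+1 w by rewrite /A big_nat_recr.
pose Z n w := expR (lambda * f n w) / A n w.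
have Z0 n w : 0 <= Z n w by rewrite divr_ge0 ?expR_ge0// ltW.
have mZ n : measurable_wrt (F n) (Z n).
  rewrite /Z; apply: measurable_funM.
    apply: measurableT_comp => //; apply: measurable_funM => //; exact: mf.
  by apply: measurable_fun_inv_gt0; [exact: A0|exact: mA].
have superZ n B : F n B ->
    (\int[P]_(w in B) (Z n.+1 w)%:E <= \int[P]_(w in B) (Z n w)%:E)%E.
  move=> FB.
  (* With this weight the two sides of the hypothesis on [a] are exactly the
     integrals of [Z n.+1] and [Z n] over [B]. *)
  pose W w := \1_B w * (Z n w / a n.+1 w).
  have mW : measurable_wrt (F n) W.
    apply: measurable_funM.
      by apply: measurable_indic; rewrite /measurable/= sigma_algebra_id.
    apply: measurable_funM; first exact: mZ.
    by apply: measurable_fun_inv_gt0; [exact: a0|exact: ma].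
  have W0 w : 0 <= W w by rewrite mulr_ge0// divr_ge0// ltW.
  have := step n W mW W0.
  congr (_ <= _)%E; rewrite [RHS]integral_mkcond; apply: eq_integral => w _;
    rewrite epatch_indic/= -EFinM /W; congr (_%:E).
    rewrite /Z AS /mdiff /= mulrBr expRB.
    have := expR_gt0 (lambda * f n w); have := A0 n w; have := a0 n.+1 w.
    by move=> /gt_eqF an /gt_eqF An /gt_eqF En; field; rewrite an An En.
  by have := gt_eqF (a0 n.+1 w) => an; field; rewrite an.
have Zint : (\int[P]_w (Z 0%N w)%:E = 1)%E.
  transitivity (\int[P]_w (cst 1%E w))%E; last first.
    by rewrite integral_cst// mul1e; exact: probability_setT.
  apply: eq_integral => w _.
  by rewrite /Z f0 mulr0 expR0 /A big_geq// invr1 mulr1.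
set E := [set w | _]; have mE : measurable E.
  rewrite -[E]setTI; apply: emeasurable_fun_c_infty => //.
  by apply: measurable_maxfun => n; apply: (measurable_wrt_measurable (sF n)).
(* The supremum may reach [r] without being attained, so only levels below
   [q^-1] are certain to be hit.  If [q < P E], the level [c] chosen strictly
   between [(P E)^-1] and [q^-1] contradicts Ville's inequality. *)
rewrite leNgt; apply/negP => qP.
set q := expR (- (lambda * r)) * M in qP.
have q0 : 0 < q by rewrite mulr_gt0// expR_gt0.
have Pfin : P E \is a fin_num by exact: fin_num_measure.
pose p := fine (P E).
have qp : q < p by rewrite -lte_fin fineK.
pose c := ((q + p) / 2)^-1.
have [qs sp] := midf_lt qp.
have s0 : 0 < (q + p) / 2 by exact: lt_trans qs.
have c0 : 0 < c by rewrite invr_gt0.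
have hit w : (forall n, A n w <= M) -> E w -> (\bigcup_n [set w | c <= Z n w]) w.
  move=> AM Ew.
  have cM0 : 0 < c * M by rewrite mulr_gt0.
  have lnr : ln (c * M) / lambda < r.
    rewrite ltr_pdivrMr// [ltRHS]mulrC -ltr_expR lnK ?posrE//.
    rewrite -[ltRHS]invrK -expRN -[ltRHS]mul1r ltr_pdivlMr ?expR_gt0//.
    by rewrite -mulrA [M * _]mulrC -/q mulrC ltr_pdivrMr ?mul1r.
  have /ereal_sup_gt[_ [n _ <-]] : ((ln (c * M) / lambda)%:E < maxfun f w)%E.
    by apply: lt_le_trans Ew; rewrite lte_fin.
  rewrite lte_fin ltr_pdivrMr// [ltRHS]mulrC => lnf; exists n => //=.
  rewrite /Z ler_pdivlMr//; apply: (@le_trans _ _ (c * M)).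
    by rewrite ler_pM2l.
  by rewrite -[c * M]lnK ?posrE// ler_expR ltW.
have [N [mN PN AN]] := ae_foralln leM.
have mU : measurable (\bigcup_n [set w | c <= Z n w]).
  apply: bigcup_measurable => n _; rewrite -[X in measurable X]setTI.
  apply: measurable_fun_le => //.
  exact: (measurable_wrt_measurable (sF n) (Fm n)).
have := ville_inequality filF Z0 mZ superZ (ltW c0).
rewrite Zint; apply/negP; rewrite -ltNge.
apply: (@lt_le_trans _ _ (c%:E * P E)%E).
  by rewrite -(fineK Pfin) -EFinM lte_fin mulrC ltr_pdivlMr// mul1r.
rewrite lee_pmul2l// -[leRHS]adde0 -PN.
apply: (le_trans _ (measureU2 _ mU mN)).
apply: le_measure; rewrite ?inE//; first exact: measurableU.
move=> w Ew; have [Nw|nNw] := pselect (N w); [by right|left].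
by apply: hit => // n; apply: contrapT => An; apply/nNw/AN => /= /(_ n).
Qed.
End exponential_supermartingale.

(** * Conditional expectations and the centered exponential moment *)

Section conditional_expectation.
Context {d : measure_display} {T : measurableType d} {R : realType}.
Variables (P : probability T R) (G : set_system T).
Hypotheses (sG : sigma_algebra [set: T] G) (GT : G `<=` measurable).

Lemma is_cond_expectation_cst (k : R) : is_cond_expectation P G (cst k) (cst k).
Proof.
split => //; first exact: measurable_cst.
exact: finite_measure_integrable_cst.
Qed.

Lemma is_cond_expectationZ (k : R) (X Y : T -> R) :
  P.-integrable [set: T] (EFin \o X) -> is_cond_expectation P G X Y ->
  is_cond_expectation P G (k \*o X) (k \*o Y).
Proof.
move=> iX [mY iY XY]; split.
- by apply: measurable_funM => //; exact: measurable_cst.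
- by rewrite (_ : EFin \o _ = (fun w => k%:E * (Y w)%:E)%E)//; exact: integrableZl.
- move=> A GA; have mA := GT GA.
  have iA (Z : T -> R) : P.-integrable [set: T] (EFin \o Z) ->
    P.-integrable A (EFin \o Z) by exact: integrableS.
  under eq_integral do rewrite /= EFinM.
  under [RHS]eq_integral do rewrite /= EFinM.
  rewrite (integralZl mA (iA _ iY)) (integralZl mA (iA _ iX)).
  by congr (_ * _)%E; exact: XY.
Qed.

Lemma is_cond_expectationD (X1 Y1 X2 Y2 : T -> R) :
  P.-integrable [set: T] (EFin \o X1) -> P.-integrable [set: T] (EFin \o X2) ->
  is_cond_expectation P G X1 Y1 -> is_cond_expectation P G X2 Y2 ->
  is_cond_expectation P G (X1 \+ X2) (Y1 \+ Y2).
Proof.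
move=> iX1 iX2 [mY1 iY1 XY1] [mY2 iY2 XY2]; split.
- exact: measurable_funD.
- exact: (integrableD measurableT iY1 iY2).
- move=> A GA; have mA := GT GA.
  have iA (Z : T -> R) : P.-integrable [set: T] (EFin \o Z) ->
    P.-integrable A (EFin \o Z) by exact: integrableS.
  rewrite (integralD_EFin mA (iA _ iY1) (iA _ iY2)).
  rewrite (integralD_EFin mA (iA _ iX1) (iA _ iX2)).
  by congr (_ + _)%E; [exact: XY1|exact: XY2].
Qed.

(** The event where [Y] is negative belongs to [G], and the integral of [Y]
    over it equals that of [X], which is nonnegative. *)
Lemma cond_expectation_ge0 (X Y : T -> R) :
  is_cond_expectation P G X Y -> (forall w, 0 <= X w) ->
  \forall w \ae P, 0 <= Y w.
Proof.
move=> [mY iY XY] X0.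
pose A := [set w | Y w < 0].
have GA : G A.
  rewrite (_ : A = Y @^-1` `]-oo, 0[%classic); last first.
    by apply/seteqP; split=> w; rewrite /= in_itv.
  by apply: measurable_wrt_preimage.
have mA := GT GA.
have iA : P.-integrable A (EFin \o Y) by exact: integrableS iY.
have : ae_eq P A (EFin \o Y) (cst 0%E).
  apply/(ae_eq_integral_abs P mA (measurable_int P iA)).
  apply/eqP; rewrite eq_le integral_ge0// andbT.
  under eq_integral => w /set_mem Aw do rewrite /= ltr0_norm// EFinN.
  rewrite integralN/=; last exact: integrable_add_def.
  by rewrite XY// leeNl oppe0 integral_ge0// => w _; rewrite lee_fin.
apply: filterS => w AY; rewrite leNgt; apply/negP => Yw.
by have [Y0] := AY Yw; rewrite Y0 ltxx in Yw.
Qed.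

(** [1 + e + lambda * Eu] is a conditional expectation of [expR (lambda * u)],
    and [expR (- (lambda * Eu))] is a [G]-measurable factor.  So the condition
    on [a] says that [a] dominates the conditional exponential moment of the
    centered variable [u - Eu]. *)
Lemma le_integral_centered_exp (u Eu e a W : T -> R) (lambda : R) :
  P.-integrable [set: T] (EFin \o u) ->
  is_cond_expectation P G u Eu ->
  ('E_P[fun w => expR (lambda * u w)] < +oo)%E ->
  is_cond_expectation P G (fun w => expR (lambda * u w) - 1 - lambda * u w) e ->
  measurable_fun [set: T] a -> (forall w, 0 <= a w) ->
  (\forall w \ae P, (1 + e w + lambda * Eu w) * expR (- (lambda * Eu w)) <= a w) ->
  measurable_wrt G W -> (forall w, 0 <= W w) ->
  (\int[P]_w (W w * expR (lambda * (u w - Eu w)))%:E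
   <= \int[P]_w (W w * a w)%:E)%E.
Proof.
move=> iu hEu hexp he ma a0 aE mW W0.
have [mEu _ _] := hEu.
have mu : measurable_fun [set: T] u by apply/measurable_EFinP/(measurable_int P).
pose X w := expR (lambda * u w).
have mX : measurable_fun [set: T] X.
  by apply: measurableT_comp => //; exact: measurable_funM.
have iX : P.-integrable [set: T] (EFin \o X).
  apply/integrableP; split; first exact/measurable_EFinP.
  under eq_integral do rewrite /= ger0_norm ?expR_ge0//.
  by move: hexp; rewrite unlock.
have ilu : P.-integrable [set: T] (EFin \o (lambda \*o u)).
  by rewrite (_ : EFin \o _ = (fun w => lambda%:E * (u w)%:E)%E)//;
    exact: integrableZl.
have i1 : P.-integrable [set: T] (EFin \o (cst 1 : T -> R)).
  exact: finite_measure_integrable_cst.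
have iX1 : P.-integrable [set: T] (EFin \o (fun w => X w - 1 - lambda * u w)).
  have := integrableB measurableT (integrableB measurableT iX i1) ilu.
  by apply: eq_integrable.
pose Y w := 1 + e w + lambda * Eu w.
have XY : is_cond_expectation P G X Y.
  have -> : X = (cst 1 \+ (fun w => X w - 1 - lambda * u w)) \+ (lambda \*o u).
    by apply/funext => w /=; ring.
  apply: is_cond_expectationD => //.
  - have := integrableD measurableT i1 iX1.
    by apply: eq_integrable.
  - by apply: is_cond_expectationD => //; exact: is_cond_expectation_cst.
  - exact: is_cond_expectationZ.
have Y0 := cond_expectation_ge0 XY (fun w => expR_ge0 _).
have [mY iY XYA] := XY.
have mYT : measurable_fun [set: T] Y by exact: measurable_wrt_measurable mY.
have mEuT : measurable_fun [set: T] Eu by exact: measurable_wrt_measurable mEu.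
have mWT : measurable_fun [set: T] W by exact: measurable_wrt_measurable mW.
pose V w := W w * expR (- (lambda * Eu w)).
have V0 w : 0 <= V w by rewrite mulr_ge0 ?expR_ge0.
have mV : measurable_wrt G V.
  apply: measurable_funM => //; apply: measurableT_comp => //.
  by apply: measurableT_comp => //; exact: measurable_funM.
have mVT : measurable_fun [set: T] V by exact: measurable_wrt_measurable mV.
have -> : (\int[P]_w (W w * expR (lambda * (u w - Eu w)))%:E =
    \int[P]_w (V w * X w)%:E)%E.
  apply: eq_integral => w _; congr (_%:E).
  by rewrite /V /X mulrBr expRD; ring.
(* [Y] is only almost surely nonnegative; [`|Y|] is the version of it to which
   the nonnegative product rule applies. *)
rewrite (@eq_ge0_integral_mul _ _ _ _ _ sG GT _ (fun w => `|Y w|))//.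
- apply: ae_ge0_le_integral => //.
  + by move=> w _; rewrite lee_fin mulr_ge0.
  + apply/measurable_EFinP/measurable_funM => //.
    exact: measurableT_comp.
  + by move=> w _; rewrite lee_fin mulr_ge0.
  + exact/measurable_EFinP/measurable_funM.
  + apply: filterS2 Y0 aE => w Yw aw _.
    by rewrite lee_fin ger0_norm// /V -mulrA ler_wpM2l// mulrC.
- exact: measurableT_comp.
- by move=> w; exact: expR_ge0.
- move=> A GA; rewrite -XYA//; apply: ae_eq_integral.
  + exact: GT.
  + exact/measurable_EFinP/measurable_funTS.
  + exact/measurable_EFinP/measurable_funTS/measurableT_comp.
  + by apply: filterS Y0 => w Yw _ /=; rewrite ger0_norm.
Qed.

End conditional_expectation.

(** * The essential supremum norm and the two bounds *)

Lemma ae_le_Lnormy {d : measure_display} {T : measurableType d} {R : realType}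
    (P : probability T R) (g : T -> \bar R) :
  \forall w \ae P, (g w <= 'N[P]_+oo[g])%E.
Proof.
have P0 : (0 < P [set: T])%E.
  by have -> : P [set: T] = 1%E by exact: probability_setT.
have -> : ('N[P]_+oo[g] = ess_sup P (abse \o g))%E by rewrite unlock P0.
by apply: filterS (ess_sup_ge P (abse \o g)) => w; apply: le_trans; exact: lee_abs.
Qed.

Lemma partial_prod_le_prod1D {d : measure_display} {T : measurableType d}
    {R : realType} (e : nat -> T -> R) n w :
  (forall j, 0 <= e j.+1 w) ->
  ((\prod_(1 <= j < n) (1 + e j w))%:E <= prod1D_from1 e w)%E.
Proof.
move=> e0.
have nd : {homo (fun n => (\prod_(1 <= j < n) (1 + e j w))%:E) :
    m n / (m <= n)%N >-> (m <= n)%E}.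
  apply/nondecreasing_seqP => -[|m]; rewrite lee_fin.
    by rewrite !big_geq.
  rewrite [leRHS]big_nat_recr//= ler_peMr ?lerDl//.
  rewrite big_add1/=; apply: prodr_ge0 => j _.
  by rewrite addr_ge0.
rewrite /prod1D_from1 (cvg_lim _ (ereal_nondecreasing_cvgn nd))//.
by apply: ereal_sup_ubound; exists n.
Qed.

Theorem theorem8p5 (d : measure_display) (T : measurableType d) (R : realType)
  (P : probability T R) (F : nat -> set_system T) (f : nat -> T -> R)
  (hf : is_martingale_from0 P F f)
  (u Eu : nat -> T -> R)
  (hu : forall j, (1 <= j)%N -> P.-integrable [set: T] (EFin \o u j))
  (hEu : forall j, (1 <= j)%N ->
     is_cond_expectation P (F j.-1) (u j) (Eu j))
  (hd : forall j, (1 <= j)%N ->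
     \forall w \ae P, mdiff f j w = u j w - Eu j w)
  (lambda : R) (hlambda : 0 < lambda)
  (hexp : forall j, (1 <= j)%N ->
     ('E_P[fun w => expR (lambda * u j w)] < +oo)%E)
  (e : nat -> T -> R)
  (he : forall j, (1 <= j)%N ->
     is_cond_expectation P (F j.-1)
       (fun w => expR (lambda * u j w) - 1 - lambda * u j w) (e j)) :
  (forall r : R, 0 <= r ->
     (P [set w | r%:E <= maxfun f w] <=
      expeR ((- (lambda * r))%:E + 'N[P]_+oo[sum_from1 e]))%E) /\
  ((forall j, (1 <= j)%N -> \forall w \ae P, 0 <= Eu j w) ->
   forall r : R, 0 <= r ->
     (P [set w | r%:E <= maxfun f w] <=
      (expR (- (lambda * r)))%:E * 'N[P]_+oo[prod1D_from1 e])%E).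
Proof.
have [[filF mf _ _] f0] := hf.
have [sF Fm _] := filF.
have mfT n : measurable_fun [set: T] (f n).
  exact: (measurable_wrt_measurable (sF n) (Fm n) (mf n)).
have e0 : \forall w \ae P, forall j, 0 <= e j.+1 w.
  apply/ae_foralln => j.
  apply: (cond_expectation_ge0 (sF j) (Fm j) (he j.+1 isT)) => w.
  have := expR_ge1Dx (lambda * u j.+1 w); lra.
have me j : measurable_wrt (F j) (e j.+1) by case: (he j.+1 isT).
have mEuT j : measurable_fun [set: T] (Eu j.+1).
  by apply: (measurable_wrt_measurable (sF j) (Fm j)); case: (hEu j.+1 isT).
have muT j : measurable_fun [set: T] (u j.+1).
  by apply/measurable_EFinP/(measurable_int P)/hu.
have bound (a : nat -> T -> R) M r :
    (forall n, measurable_wrt (F n) (a n.+1)) -> (forall n w, 0 < a n w) ->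
    (forall n, \forall w \ae P,
      (1 + e n.+1 w + lambda * Eu n.+1 w) * expR (- (lambda * Eu n.+1 w))
      <= a n.+1 w) ->
    0 < M -> (forall n, \forall w \ae P, \prod_(1 <= j < n.+1) a j w <= M) ->
    (P [set w | r%:E <= maxfun f w] <= (expR (- (lambda * r)) * M)%:E)%E.
  move=> ma a0 ea M0 aM.
  apply: (exponential_maximal_inequality filF r mf f0 ma a0) => // n W mW W0.
  have mWT := measurable_wrt_measurable (sF n) (Fm n) mW.
  have maT := measurable_wrt_measurable (sF n) (Fm n) (ma n).
  apply: le_trans (le_integral_centered_exp (sF n) (Fm n) (hu n.+1 isT)
    (hEu n.+1 isT) (hexp n.+1 isT) (he n.+1 isT) maT (fun w => ltW (a0 n.+1 w))
    (ea n) mW W0).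
  rewrite le_eqVlt; apply/orP; left; apply/eqP; apply: ae_eq_integral => //.
  - apply/measurable_EFinP/measurable_funM => //; apply: measurableT_comp => //.
    by apply: measurable_funM => //; exact: measurable_funB.
  - apply/measurable_EFinP/measurable_funM => //; apply: measurableT_comp => //.
    by apply: measurable_funM => //; exact: measurable_funB.
  - by apply: filterS (hd n.+1 isT) => w /= -> _.
split=> [r _|Eu0 r _].
- have : (0 <= 'N[P]_+oo[sum_from1 e])%E by exact: Lnorm_ge0.
  have := ae_le_Lnormy P (sum_from1 e).
  case: ('N[P]_+oo[sum_from1 e])%E => [M||]// leM _; last by rewrite leey.
  rewrite /= expRD; apply: (bound (fun j w => expR (e j w))).
  + by move=> n; apply: measurableT_comp => //; exact: me.
  + by move=> n w; exact: expR_gt0.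
  (* Multiplied by [exp m], the claim is [1 + (e + m) <= exp (e + m)]. *)
  + move=> n; apply: aeW => w; rewrite expRN ler_pdivrMr ?expR_gt0// -expRD.
    by rewrite -addrA; exact: expR_ge1Dx.
  + exact: expR_gt0.
  + move=> n; apply: filterS2 e0 leM => w ew leM.
    rewrite -expR_sum ler_expR -lee_fin -sumEFin; apply: le_trans leM.
    by apply: nneseries_lim_ge => -[//|j] _ _; rewrite lee_fin.
(* The product is at least its empty part [1]; this keeps the bound positive
   and settles the case of an infinite norm. *)
- have : (1 <= 'N[P]_+oo[prod1D_from1 e])%E.
    rewrite unlock.
    have P0 : (0 < P [set: T])%E.
      by have -> : P [set: T] = 1%E by exact: probability_setT.
    rewrite P0; apply: ess_sup_gee => //; apply: filterS e0 => w ew.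
    apply: le_trans (lee_abs _); apply: le_trans (partial_prod_le_prod1D 0 ew).
    by rewrite big_geq.
  have := ae_le_Lnormy P (prod1D_from1 e).
  case: ('N[P]_+oo[prod1D_from1 e])%E => [M||]// leM M1; last first.
    by rewrite gt0_muley ?leey// lte_fin expR_gt0.
  (* The absolute value makes the factors positive at every point, also where
     [e j] fails to be nonnegative. *)
  rewrite -EFinM; apply: (bound (fun j w => 1 + `|e j w|)).
  + move=> n; apply: measurable_funD; first exact: measurable_cst.
    by apply: measurableT_comp => //; exact: me.
  + by move=> n w; rewrite ltr_wpDr.
  + move=> n; apply: filterS2 e0 (Eu0 n.+1 isT) => w ew Euw.
    rewrite ger0_norm ?ew// expRN ler_pdivrMr ?expR_gt0//.
    have := expR_ge1Dx (lambda * Eu n.+1 w).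
    have : 0 <= lambda * Eu n.+1 w by rewrite mulr_ge0// ltW.
    have := ew n; nra.
  + by apply: lt_le_trans (ltr01) _; rewrite -lee_fin.
  + move=> n; apply: filterS2 e0 leM => w ew leM.
    rewrite -lee_fin; apply: le_trans leM.
    apply: le_trans (partial_prod_le_prod1D n.+1 ew); rewrite lee_fin.
    rewrite le_eqVlt; apply/orP; left; apply/eqP.
    by apply: eq_big_nat => -[//|j] _; rewrite ger0_norm.
Qed.
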